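(* Let $(G,\oplus)$ be a gyrogroup. Then the set $\mathrm{Sym}(G)$ of all permutations of $G$ is a gyrogroup under the operation $\oplus$ defined by $$\sigma\oplus\tau=L_{a\oplus b}\circ(\gamma\circ\delta),$$ where $\sigma=L_a\circ\gamma$ and $\tau=L_b\circ\delta$ are the unique factorizations with $a,b\in G$ and $\gamma,\delta\in\mathrm{Stab}(0)$. Moreover $$L_a\oplus L_b=L_a\oplus_{\overline{G}}L_b=L_{a\oplus b}$$ for all $a,b\in G$. In particular, the map $a\mapsto L_a$ is an injective gyrogroup homomorphism from $G$ into $\mathrm{Sym}(G)$.
   Context: A gyrogroup is a nonempty set $G$ with a binary operation $\oplus$ such that: (G1) there is $0\in G$ with $0\oplus a=a$ for all $a$; (G2) for each $a$ there is $b$ with $b\oplus a=0$; (G3) for all $a,b\in G$ there is an automorphism $\mathrm{gyr}[a,b]$ of $(G,\oplus)$ (a bijection $G\to G$ preserving $\oplus$) with $a\oplus(b\oplus c)=(a\oplus b)\oplus\mathrm{gyr}[a,b]c$ for all $c\in G$; (G4) $\mathrm{gyr}[a,b]=\mathrm{gyr}[a\oplus b,b]$ for all $a,b\in G$. It is known that $0$ is a two-sided identity and every $a$ has a two-sided inverse $\ominus a$. A gyrogroup homomorphism is a map between gyrogroups preserving the operations. For $a\in G$, $L_a\colon G\to G$, $L_a(x)=a\oplus x$ (a permutation of $G$), and $\overline{G}=\{L_a:a\in G\}$, which carries the gyrogroup operation $L_a\oplus_{\overline{G}}L_b:=L_{a\oplus b}$. $\mathrm{Stab}(0)=\{\rho\in\mathrm{Sym}(G):\rho(0)=0\}$.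 Every $\sigma\in\mathrm{Sym}(G)$ can be written uniquely as $\sigma=L_a\circ\rho$ with $a\in G$, $\rho\in\mathrm{Stab}(0)$, so the operation on $\mathrm{Sym}(G)$ is well defined. *)

(* Defs.v *)
From mathcomp Require Import all_boot.
From mathcomp Require Import boolp.

Set Implicit Arguments.
Unset Strict Implicit.
Unset Printing Implicit Defensive.

Declare Scope gyro_scope.
Delimit Scope gyro_scope with gyro.
Local Open Scope gyro_scope.

Definition is_automorphism (T : Type) (op : T -> T -> T) (f : T -> T) : Prop :=
  bijective f /\ forall x y, f (op x y) = op (f x) (f y).

Record gyrogroup_axioms (T : Type) (op : T -> T -> T) (zero : T) : Prop :=
  GyrogroupAxioms {
    gyro_left_id : forall a, op zero a = a;
    gyro_left_inv : forall a, exists b, op b a = zero;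
    gyro_gyr : exists gyr : T -> T -> T -> T,
      [/\ forall a b, is_automorphism op (gyr a b),
          forall a b c, op a (op b c) = op (op a b) (gyr a b c)
        & forall a b, gyr a b =1 gyr (op a b) b]
  }.

Definition is_gyrogroup (T : Type) (op : T -> T -> T) : Prop :=
  exists zero, gyrogroup_axioms op zero.

Record gyrogroup := Gyrogroup {
  gcarrier :> Type;
  gadd : gcarrier -> gcarrier -> gcarrier;
  gzero : gcarrier;
  gaxioms : gyrogroup_axioms gadd gzero
}.

Notation "a \oplus b" := (gadd a b)
  (at level 50, left associativity) : gyro_scope.

Definition is_gyrohom (T U : Type) (opT : T -> T -> T) (opU : U -> U -> U)
    (f : T -> U) : Prop :=
  forall x y, f (opT x y) = opU (f x) (f y).

(* MathComp's {perm T} requires T to be finite; here T is arbitrary. *)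
Record Sym (T : Type) := MkSym {
  sym_fun :> T -> T;
  sym_bij : bijective sym_fun
}.

Lemma sym_eqP (T : Type) (s t : Sym T) : s =1 t -> s = t.
Proof.
case: s t => [f bf] [g bg] /= /funext fg.
by rewrite fg in bf *; congr MkSym; apply: Prop_irrelevance.
Qed.

Definition sym_comp (T : Type) (s t : Sym T) : Sym T :=
  MkSym (bij_comp (sym_bij s) (sym_bij t)).

Notation "s \circ t" := (sym_comp s t)
  (at level 48, left associativity) : gyro_scope.

Lemma left_inv_cancel (G : gyrogroup) (x a : G) :
  x \oplus a = gzero G -> cancel (gadd a) (gadd x).
Proof.
have [id0 linv [gyr [gyr_aut gyr_assoc gyr_loop]]] := gaxioms G.
have inj_add (b : G) : injective (gadd b).
  move=> c d bcd; have [y yb] := linv b; have [[g gK _] _] := gyr_aut y b.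
  apply: (can_inj gK); rewrite -[LHS]id0 -[RHS]id0 -yb.
  by rewrite -!gyr_assoc bcd.
move=> xa0 c; rewrite gyr_assoc xa0 id0 gyr_loop xa0.
by apply: (inj_add a); rewrite -{1}(id0 a) -gyr_assoc id0.
Qed.

Lemma ladd_bij (G : gyrogroup) (a : G) : bijective (gadd a).
Proof.
have [x xa] := gyro_left_inv (gaxioms G) a.
have [y yx] := gyro_left_inv (gaxioms G) x.
have aK := left_inv_cancel xa; have xK := left_inv_cancel yx.
by exists (gadd x) => // c; apply: (can_inj xK); rewrite aK.
Qed.

Lemma gyro_right_id (G : gyrogroup) (a : G) : a \oplus gzero G = a.
Proof.
have [x xa] := gyro_left_inv (gaxioms G) a.
apply: (bij_inj (ladd_bij x)).
by rewrite (left_inv_cancel xa) xa.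
Qed.

Definition L (G : gyrogroup) (a : G) : Sym G := MkSym (ladd_bij a).

Definition Stab0 (G : gyrogroup) (r : Sym G) : Prop := r (gzero G) = gzero G.

Definition is_factorization (G : gyrogroup) (s : Sym G) (p : G * Sym G) : Prop :=
  Stab0 p.2 /\ s = L p.1 \circ p.2.

Lemma factorization_unique_exists (G : gyrogroup) (s : Sym G) :
  exists! p : G * Sym G, is_factorization s p.
Proof.
pose a := s (gzero G); have [g gK Kg] := ladd_bij a.
have bg : bijective g by exists (gadd a).
exists (a, MkSym bg \circ s); split.
  split; last by apply: sym_eqP => x /=; rewrite Kg.
  by rewrite /Stab0 /= -/a -{1}(gyro_right_id a) gK.
case=> b r [/= r0 sE].
have ab : a = b by rewrite /a sE /= r0 gyro_right_id.
congr pair => //; apply: sym_eqP => x /=.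
by rewrite sE /= -ab gK.
Qed.

Lemma factorization_exists (G : gyrogroup) (s : Sym G) :
  exists p : G * Sym G, is_factorization s p.
Proof. by have [p [ps _]] := factorization_unique_exists s; exists p. Qed.

Definition factorization (G : gyrogroup) (s : Sym G) : G * Sym G :=
  sval (cid (factorization_exists s)).

Definition sym_add (G : gyrogroup) (s t : Sym G) : Sym G :=
  let: (a, g) := factorization s in
  let: (b, d) := factorization t in
  L (a \oplus b) \circ (g \circ d).

Definition Gbar (G : gyrogroup) : Type := {s : Sym G | exists a : G, s = L a}.

Definition Lbar (G : gyrogroup) (a : G) : Gbar G :=
  exist _ (L a) (ex_intro _ a erefl).

(* The index a of an element L_a of Gbar is unique since L_a(0) = a. *)
Definition Gbar_index (G : gyrogroup) (s : Gbar G) : G := sval (cid (svalP s)).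

Definition Gbar_add (G : gyrogroup) (s t : Gbar G) : Gbar G :=
  Lbar (Gbar_index s \oplus Gbar_index t).

(* Main.v *)
Require Import Defs.
From mathcomp Require Import all_boot.
From mathcomp Require Import boolp.

(** The factorization [s = L a \circ r] identifies [Sym G] with
    [G * Stab0], and under this identification [sym_add] is the componentwise
    operation of the direct product of the gyrogroup [G] with the group [Stab0]
    ([sym_add_factored]).  A direct product of a gyrogroup and a group is a
    gyrogroup: a gyration of the product is a gyration of [G] on the first
    component and the identity on the second, because the group component is
    already associative.  So each axiom for [Sym G] follows from the same axiom
    for [G] once all the permutations involved are written in factored form.

    The remaining claims concern the slice [r = id]: [L a] factors as
    [L a \circ id], which gives the homomorphism property, and [L a] determines
    [a] as its value at zero, which gives injectivity and makes the operation
    on [Gbar] computable on representatives. *)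

Set Implicit Arguments.
Unset Strict Implicit.
Unset Printing Implicit Defensive.

Local Open Scope gyro_scope.

Definition sym_id (T : Type) : Sym T := MkSym (Bijective (frefl id) (frefl id)).

Lemma sym_left_inverse (T : Type) (s : Sym T) :
  exists t : Sym T, t \circ s = sym_id T.
Proof.
have [f sK fK] := sym_bij s.
by exists (MkSym (Bijective fK sK)); apply: sym_eqP => x /=; rewrite sK.
Qed.

Lemma sym_compA (T : Type) (r s t : Sym T) :
  r \circ (s \circ t) = r \circ s \circ t.
Proof. exact: sym_eqP. Qed.

Lemma sym_comp_idl (T : Type) (s : Sym T) : sym_id T \circ s = s.
Proof. exact: sym_eqP. Qed.

Lemma sym_comp_idr (T : Type) (s : Sym T) : s \circ sym_id T = s.
Proof. exact: sym_eqP. Qed.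

Section SymGyrogroup.

Variable G : gyrogroup.
Implicit Types (a b c : G) (r s t : Sym G).

Lemma Stab0_id : Stab0 (sym_id G). Proof. by []. Qed.

Lemma Stab0_comp r s : Stab0 r -> Stab0 s -> Stab0 (r \circ s).
Proof. by rewrite /Stab0 /= => r0 ->. Qed.

(** [Stab0] is a subgroup, so the second component of a left inverse in
    [G * Stab0] can be taken in [Stab0]. *)
Lemma Stab0_left_inverse r :
  Stab0 r -> exists2 s, Stab0 s & s \circ r = sym_id G.
Proof.
move=> r0; have [s sr] := sym_left_inverse r; exists s => //.
by rewrite /Stab0 -{1}r0 -[s (r _)]/((s \circ r) _) sr.
Qed.

Lemma L_inj : injective (@L G).
Proof.
move=> a b eqL.
by rewrite -[a]gyro_right_id -[b]gyro_right_id -[LHS]/(L a _) eqL.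
Qed.

Lemma factorizationE a r : Stab0 r -> factorization (L a \circ r) = (a, r).
Proof.
move=> r0; have [p [_ p_uniq]] := factorization_unique_exists (L a \circ r).
rewrite -(p_uniq (a, r)) //; apply/esym/p_uniq.
by rewrite /factorization; case: cid.
Qed.

(** Elimination form of the factorization: a claim about every permutation need
    only be checked on factored ones, where [factorizationE] computes. *)
Lemma Sym_factored_ind (P : Sym G -> Prop) :
  (forall a r, Stab0 r -> P (L a \circ r)) -> forall s, P s.
Proof.
by move=> PLr s; have [[a r] [/= r0 ->]] := factorization_exists s; apply: PLr.
Qed.

Lemma sym_add_factored a b r s : Stab0 r -> Stab0 s ->
  sym_add (L a \circ r) (L b \circ s) = L (a \oplus b) \circ (r \circ s).
Proof. by move=> r0 s0; rewrite /sym_add !factorizationE. Qed.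

Lemma sym_add_L a b : sym_add (L a) (L b) = L (a \oplus b).
Proof.
rewrite -[L a]sym_comp_idr -[L b]sym_comp_idr.
by rewrite (sym_add_factored _ _ Stab0_id Stab0_id) !sym_comp_idr.
Qed.

Lemma Gbar_index_Lbar a : Gbar_index (Lbar a) = a.
Proof. by apply: L_inj; rewrite /Gbar_index; case: cid => b /= <-. Qed.

(** The map [f * id] of [G * Stab0], read through the factorization. *)
Definition map_translation (f : G -> G) (s : Sym G) : Sym G :=
  let: (a, r) := factorization s in L (f a) \circ r.

Lemma map_translation_factored f a r :
  Stab0 r -> map_translation f (L a \circ r) = L (f a) \circ r.
Proof. by move=> r0; rewrite /map_translation factorizationE. Qed.

Lemma map_translation_cancel f g :
  cancel f g -> cancel (map_translation f) (map_translation g).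
Proof.
move=> fK; apply: Sym_factored_ind => a r r0.
by rewrite !map_translation_factored // fK.
Qed.

Lemma map_translation_automorphism f :
  is_automorphism (@gadd G) f -> is_automorphism (@sym_add G) (map_translation f).
Proof.
case=> [[g fK gK] fD]; split.
  by exists (map_translation g); apply: map_translation_cancel.
elim/Sym_factored_ind => a r r0; elim/Sym_factored_ind => b s s0.
by rewrite sym_add_factored // !map_translation_factored ?sym_add_factored ?fD //;
  apply: Stab0_comp.
Qed.

Lemma sym_add_gyrogroup : gyrogroup_axioms (@sym_add G) (L (gzero G)).
Proof.
have [add0 addV [gyr [gyr_aut gyr_assoc gyr_loop]]] := gaxioms G.
split.
- elim/Sym_factored_ind => a r r0.
  rewrite -[X in sym_add X _]sym_comp_idr (sym_add_factored _ _ Stab0_id r0).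
  by rewrite add0 sym_comp_idl.
- elim/Sym_factored_ind => a r r0.
  have [b ba] := addV a; have [s s0 sr] := Stab0_left_inverse r0.
  by exists (L b \circ s); rewrite sym_add_factored // ba sr sym_comp_idr.
(* The factors in [Stab0] compose associatively, so only the failure of
   associativity in [G] has to be corrected. *)
exists (fun s t =>
  map_translation (gyr (factorization s).1 (factorization t).1)); split.
- by move=> s t; apply/map_translation_automorphism/gyr_aut.
- elim/Sym_factored_ind => a r r0; elim/Sym_factored_ind => b s s0.
  elim/Sym_factored_ind => c t t0.
  have rs0 := Stab0_comp r0 s0; have st0 := Stab0_comp s0 t0.
  rewrite !factorizationE // map_translation_factored // !sym_add_factored //.
  by rewrite gyr_assoc (sym_compA r).
- elim/Sym_factored_ind => a r r0; elim/Sym_factored_ind => b s s0.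
  have rs0 := Stab0_comp r0 s0.
  elim/Sym_factored_ind => c t t0.
  rewrite sym_add_factored // !factorizationE // !map_translation_factored //.
  by rewrite gyr_loop.
Qed.

End SymGyrogroup.

Theorem theorem3p3 (G : gyrogroup) :
  [/\ is_gyrogroup (@sym_add G),
      forall a b : G,
        sym_add (L a) (L b) = sval (Gbar_add (Lbar a) (Lbar b)) /\
        sval (Gbar_add (Lbar a) (Lbar b)) = L (a \oplus b),
      injective (@L G)
    & is_gyrohom (@gadd G) (@sym_add G) (@L G)].
Proof.
split.
- by exists (L (gzero G)); apply: sym_add_gyrogroup.
- by move=> a b; rewrite /Gbar_add !Gbar_index_Lbar sym_add_L.
- exact: L_inj.
- by move=> a b; rewrite sym_add_L.
Qed.
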